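(* There exist universal constants $\mu_2>0$ and $0<\nu_2<1$ such that the following holds. Let $S$ be an arbitrary proper sampling with average minibatch size $b=\mathrm{E}|S|$, let $v$ satisfy $\mathbf{P}-pp^\top\preceq \mathrm{Diag}(p_1v_1,\dots,p_nv_n)$, and let $\alpha$ be the associated quantity defined in the context. Suppose $b\le \alpha n^{2/3}$, and run SVRG with arbitrary sampling from $x^0$ with step size $\eta=\dfrac{\mu_2 b}{\alpha\bar L n^{2/3}}$, inner loop length $m=\left\lfloor \dfrac{n\alpha}{3b\mu_2}\right\rfloor$ and $T$ a multiple of $m$ (with auxiliary analysis parameter $\beta=\bar L/n^{1/3}$, which does not enter the algorithm). Then the output $x_a$ satisfies $$\mathrm{E}\|\nabla f(x_a)\|^2\le \frac{\alpha \bar L n^{2/3}\,[f(x^0)-f(x^* )]}{bT\nu_2}.$$ Thus, measured in stochastic gradient evaluations, to obtain an $\epsilon$-accurate solution one needs $$\max\left\{n,\ \frac{\mu_2\bar L n^{2/3}(f(x^0)-f(x^* ))}{\epsilon\nu_2}\left(1+\frac{\alpha}{3\mu_2}\right)\right\}$$ evaluations.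
   Context: Problem: $f(x)=\frac1n\sum_{i=1}^n f_i(x)$ with $f_i:\mathbb{R}^d\to\mathbb{R}$ differentiable, $L_i$-smooth ($\|\nabla f_i(x)-\nabla f_i(y)\|\le L_i\|x-y\|$ for all $x,y$), not necessarily convex; $f$ has a minimizer $x^*$; $\bar L=\frac1n\sum_{i=1}^n L_i>0$. A random point $x_a$ is $\epsilon$-accurate if $\mathrm{E}\|\nabla f(x_a)\|^2\le\epsilon$. Sampling: a sampling $S$ is a random subset of $[n]=\{1,\dots,n\}$; $\mathbf{P}_{ij}=\mathrm{Prob}(\{i,j\}\subseteq S)$ is its probability matrix, $p_i=\mathrm{Prob}(i\in S)$, $p=(p_1,\dots,p_n)^\top$; $S$ is proper if $p_i>0$ for all $i$; $b=\mathrm{E}|S|=\sum_i p_i$. For $v\in\mathbb{R}^n$ with $\mathbf{P}-pp^\top\preceq\mathrm{Diag}(p_1v_1,\dots,p_nv_n)$ set $K=\frac{b}{n^2}\sum_{i=1}^n\frac{v_iL_i^2}{p_i}$ and $\alpha=K/\bar L^2$. SVRG with arbitrary sampling $(x^0,m,T,\eta,S)$: set $\tilde x^0=x^0_m=x^0$, $M=\lceil T/m\rceil$. For $s=0,\dots,M-1$: $x_0^{s+1}=x_m^s$, $g^{s+1}=\frac1n\sum_{i=1}^n\nabla f_i(\tilde x^s)$; for $t=0,\dots,m-1$: draw a fresh independent random set $S_t\sim S$, set $v_t^{s+1}=\sum_{i\in S_t}\frac{1}{np_i}\left(\nabla f_i(x_t^{s+1})-\nabla f_i(\tilde x^s)\right)+g^{s+1}$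 and $x_{t+1}^{s+1}=x_t^{s+1}-\eta v_t^{s+1}$; then $\tilde x^{s+1}=x_m^{s+1}$. Output: $x_a$ chosen uniformly at random from $\{x_t^{s+1}:0\le t\le m-1,\ 0\le s\le M-1\}$. Each outer loop is counted as $n+mb$ stochastic gradient evaluations.
   Formalization: That some run with at most max{n,…} evaluations is ε-accurate is claimed only if one outer loop (n+mb evaluations) fits in this number, since otherwise no run does; it is also shown that every run with at least that many evaluations is ε-accurate. *)

(* Defs.v *)
From HB Require Import structures.
From mathcomp Require Import all_boot all_order all_algebra.
From mathcomp Require Import all_classical all_reals all_analysis.

Set Implicit Arguments.
Unset Strict Implicit.
Unset Printing Implicit Defensive.

Import Order.TTheory GRing.Theory Num.Theory.
Import numFieldNormedType.Exports.
Local Open Scope ring_scope.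

Section FiniteProbability.
Context {R : realType}.

Definition is_pmf (T : finType) (mu : T -> R) : Prop :=
  (forall x, 0 <= mu x) /\ \sum_x mu x = 1.

Definition Prob (T : finType) (mu : T -> R) (A : pred T) : R :=
  \sum_(x | A x) mu x.

Definition Expect (T : finType) (mu : T -> R) (F : T -> R) : R :=
  \sum_x mu x * F x.

Definition uniform_pmf (T : finType) : T -> R := fun=> (#|T|%:R)^-1.

Definition prod_pmf (T U : finType) (mu : T -> R) (nu : U -> R) : T * U -> R :=
  fun z => mu z.1 * nu z.2.

Definition iid_pmf (I T : finType) (mu : T -> R) : {ffun I -> T} -> R :=
  fun w => \prod_i mu (w i).

Lemma uniform_pmfP (T : finType) : (0 < #|T|)%N -> is_pmf (@uniform_pmf T).
Proof.
move=> T0; split=> [x|]; first by rewrite invr_ge0.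
by rewrite sumr_const -[_ *+ _]mulr_natr mulVf // pnatr_eq0 -lt0n.
Qed.

Lemma prod_pmfP (T U : finType) (mu : T -> R) (nu : U -> R) :
  is_pmf mu -> is_pmf nu -> is_pmf (prod_pmf mu nu).
Proof.
move=> [mu0 mu1] [nu0 nu1]; split=> [z|]; first exact: mulr_ge0.
rewrite -(pair_bigA _ (fun x y => mu x * nu y)) /=.
by under eq_bigr do rewrite -mulr_sumr nu1 mulr1.
Qed.

Lemma iid_pmfP (I T : finType) (mu : T -> R) :
  is_pmf mu -> is_pmf (@iid_pmf I T mu).
Proof.
move=> [mu0 mu1]; split=> [w|]; first exact: prodr_ge0.
rewrite -(bigA_distr_bigA (fun=> mu)) /=.
by rewrite big1.
Qed.

End FiniteProbability.

Section EuclideanSpace.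
Context {R : realType} {d : nat}.
Implicit Types (g : 'rV[R]_d -> R) (x y : 'rV[R]_d).

(* The library's norm on 'rV[R]_d is the sup norm. *)
Definition enorm x : R := Num.sqrt (\sum_j x 0 j ^+ 2).

(* Meaningful when g is differentiable at x: the row vector representing the
   differential of g at x. *)
Definition grad g x : 'rV[R]_d := \row_j 'd g x (delta_mx 0 j).

Definition smooth (L : R) g : Prop :=
  (forall x, differentiable g x) /\
  forall x y, enorm (grad g x - grad g y) <= L * enorm (x - y).

End EuclideanSpace.

Definition loewner_le {R : realType} {n : nat} (A B : 'M[R]_n) : Prop :=
  (B - A)^T = B - A /\
  forall z : 'cV[R]_n, 0 <= (z^T *m (B - A) *m z) 0 0.

(* A sampling of [n] is given by its law q : {set 'I_n} -> R. *)
Section Sampling.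
Context {R : realType} {n : nat}.
Implicit Types (q : {set 'I_n} -> R) (L v : 'I_n -> R).

Definition prob_mx q : 'M[R]_n :=
  \matrix_(i, j) Prob q (fun A : {set 'I_n} => [set i; j] \subset A).

Definition incl_prob q (i : 'I_n) : R :=
  Prob q (fun A : {set 'I_n} => i \in A).

Definition incl_vec q : 'cV[R]_n := \col_i incl_prob q i.

Definition proper_sampling q : Prop := forall i, 0 < incl_prob q i.

Definition avg_size q : R := Expect q (fun A : {set 'I_n} => #|A|%:R).

Definition eso q v : Prop :=
  loewner_le (prob_mx q - incl_vec q *m (incl_vec q)^T)
             (diag_mx (\row_i (incl_prob q i * v i))).

Definition Lbar L : R := n%:R^-1 * \sum_i L i.

Definition Kconst q v L : R :=
  avg_size q / n%:R ^+ 2 * \sum_i v i * L i ^+ 2 / incl_prob q i.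

Definition alpha q v L : R := Kconst q v L / Lbar L ^+ 2.

End Sampling.

Section SVRG.
Context {R : realType} {n d : nat}.
Variables (q : {set 'I_n} -> R) (f : 'I_n -> 'rV[R]_d -> R).

Definition favg (x : 'rV[R]_d) : R := n%:R^-1 * \sum_i f i x.

Definition full_grad (xt : 'rV[R]_d) : 'rV[R]_d :=
  n%:R^-1 *: \sum_i grad (f i) xt.

Definition svrg_dir (xt x : 'rV[R]_d) (A : {set 'I_n}) : 'rV[R]_d :=
  \sum_(i in A) (n%:R * incl_prob q i)^-1 *: (grad (f i) x - grad (f i) xt)
  + full_grad xt.

Variables (eta : R) (x0 : 'rV[R]_d) (m : nat).

(* Iterates of one inner loop started at its snapshot xt, with St t the set
   drawn at step t. *)
Fixpoint inner (xt : 'rV[R]_d) (St : nat -> {set 'I_n}) (t : nat) :=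
  if t is t'.+1 then
    let x := inner xt St t' in x - eta *: svrg_dir xt x (St t')
  else xt.

(* snapshot S s is the s-th snapshot; since it is the last iterate of the
   preceding inner loop, it is also the point where inner loop s starts. *)
Fixpoint snapshot (S : nat -> nat -> {set 'I_n}) (s : nat) : 'rV[R]_d :=
  if s is s'.+1 then inner (snapshot S s') (S s') m else x0.

Definition iterate (S : nat -> nat -> {set 'I_n}) (s t : nat) : 'rV[R]_d :=
  inner (snapshot S s) (S s) t.

Definition outer_loops (T : nat) : nat := `|Num.ceil (T%:R / m%:R : R)|%N.

(* A finite table of draws read as a doubly indexed family; the default empty
   set lies outside the range used by the algorithm. *)
Definition draws (M : nat) (w : {ffun 'I_M * 'I_m -> {set 'I_n}})
    (s t : nat) : {set 'I_n} :=
  if (insub s, insub t) is (Some i, Some j) then w (i, j) else finset.set0.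

(* Sample space of a run: the table of draws and the pair (s, t) of the
   iterate that is returned. *)
Definition outcome (M : nat) : finType :=
  ({ffun 'I_M * 'I_m -> {set 'I_n}} * ('I_M * 'I_m))%type.

Definition run_pmf (M : nat) : outcome M -> R :=
  prod_pmf (iid_pmf q) (@uniform_pmf R ('I_M * 'I_m)%type).

Definition svrg_output (M : nat) (o : outcome M) : 'rV[R]_d :=
  iterate (draws o.1) o.2.1 o.2.2.

Definition svrg_sq_grad (T : nat) : R :=
  Expect (@run_pmf (outer_loops T))
         (fun o => enorm (grad favg (svrg_output o)) ^+ 2).

Definition svrg_accurate (T : nat) (eps : R) : Prop := svrg_sq_grad T <= eps.

(* Stochastic gradient evaluations, n + m b per outer loop. *)
Definition svrg_evals (T : nat) : R :=
  (outer_loops T)%:R * (n%:R + m%:R * avg_size q).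

End SVRG.

(* Main.v *)
Require Import Defs.
From HB Require Import structures.
From mathcomp Require Import all_boot all_order all_algebra.
From mathcomp Require Import all_classical all_reals all_analysis.
From mathcomp Require Import ring lra.

Set Implicit Arguments.
Unset Strict Implicit.
Unset Printing Implicit Defensive.

Import Order.TTheory GRing.Theory Num.Theory.
Import numFieldNormedType.Exports.
Local Open Scope ring_scope.

(** Why the theorem holds.  Within one epoch, with snapshot [xt], the quantity
    f (x_t) + c_t |x_t - xt|^2 decreases in conditional expectation by a
    multiple of |grad f (x_t)|^2, provided that the weights c_t decrease to
    c_m = 0 fast enough to absorb the variance of the stochastic direction.
    Three facts give this.

    - [smooth_descent]: a smooth function lies below its quadratic model.
    - [Expect_weighted_est] and [Expect_sqr_weighted_est]: the direction is
      unbiased, and the matrix inequality on the sampling bounds its variance;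
      for the SVRG direction the bound is (K / b) |x - xt|^2
      ([Expect_sqr_svrg_dir]).
    - [potential_step]: the two above, plus Young's inequality with parameter
      beta for the cross term <grad f x, x - xt>, give the one-step inequality.

    Since c_m = 0 and an epoch starts at distance 0 from its snapshot, the
    potential agrees with f at both ends of an epoch; hence the one-step
    inequalities telescope over the whole run to
    gamma * sum E |grad f (x_t)|^2 <= f x0 - f xstar, which is
    [Expect_output_sqr_grad].  Conditional expectations over the finite table
    of independent draws are handled by redrawing a single entry of the table,
    which does not change its law ([Expect_redraw]).

    For the constants, put k = n^(1/3) and r = b / (alpha k^2) <= 1, and take
    mu2 = 1/4.  Then eta = r / (4 Lbar), K / b = Lbar^2 / (r k^2),
    beta = Lbar / k, and the choice of m says m r <= 4 k / 3.  With these values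
    weights that are linear in m - t satisfy the recursion
    ([potential_weight_rec]) and leave gamma = eta / 2
    ([potential_weight_gain]), so E |grad f (x_a)|^2 is at most
    8 alpha Lbar n^(2/3) (f x0 - f xstar) / (b T) ([svrg_rate]).

    Taking nu2 = 1/96 rather than 1/8 leaves a factor 12 which pays for the
    evaluation count: rounding m down costs a factor 2, rounding the number of
    epochs down costs another 2, and the comparison of n + m b evaluations per
    epoch with the announced bound costs the rest.  The condition
    b <= alpha n^(2/3), with mu2 <= 1/3, also ensures m >= 1. *)

(** * Euclidean inner product on row vectors *)

Section Dot.
Context {R : realType} {d : nat}.
Implicit Types (x y z : 'rV[R]_d) (a : R).

Definition dot x y : R := \sum_j x 0 j * y 0 j.

Lemma dotC x y : dot x y = dot y x.
Proof. by apply: eq_bigr => j _; rewrite mulrC. Qed.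

Lemma dotDl x y z : dot (x + y) z = dot x z + dot y z.
Proof. by rewrite -big_split; apply: eq_bigr => j _; rewrite !mxE mulrDl. Qed.

Lemma dotZl a x y : dot (a *: x) y = a * dot x y.
Proof. by rewrite mulr_sumr; apply: eq_bigr => j _; rewrite !mxE mulrA. Qed.

Lemma dotDr x y z : dot z (x + y) = dot z x + dot z y.
Proof. by rewrite !(dotC z) dotDl. Qed.

Lemma dotZr a x y : dot y (a *: x) = a * dot y x.
Proof. by rewrite !(dotC y) dotZl. Qed.

Lemma dotNl x y : dot (- x) y = - dot x y.
Proof. by rewrite -scaleN1r dotZl mulN1r. Qed.

Lemma dotNr x y : dot y (- x) = - dot y x.
Proof. by rewrite !(dotC y) dotNl. Qed.

Definition dotE := (dotDl, dotDr, dotNl, dotNr, dotZl, dotZr).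

Lemma dot_suml (I : finType) (P : pred I) (u : I -> 'rV[R]_d) y :
  dot (\sum_(i | P i) u i) y = \sum_(i | P i) dot (u i) y.
Proof.
rewrite exchange_big /=; apply: eq_bigr => j _.
by rewrite summxE mulr_suml.
Qed.

Lemma dot_ge0 x : 0 <= dot x x.
Proof. by apply: sumr_ge0 => j _; rewrite -expr2 sqr_ge0. Qed.

Lemma enorm_ge0 x : 0 <= enorm x.
Proof. exact: sqrtr_ge0. Qed.

Lemma sqr_enorm x : enorm x ^+ 2 = dot x x.
Proof.
rewrite sqr_sqrtr; first by apply: eq_bigr => j _; rewrite expr2.
by apply: sumr_ge0 => j _; exact: sqr_ge0.
Qed.

Lemma enorm0_eq0 x : enorm x = 0 -> x = 0.
Proof.
move=> x0; have : dot x x = 0 by rewrite -sqr_enorm x0 expr0n.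
move/eqP; rewrite psumr_eq0; last by move=> j _; rewrite -expr2 sqr_ge0.
move/allP => xj; apply/rowP => j; rewrite mxE.
by have /= := xj j (mem_index_enum _); rewrite -expr2 sqrf_eq0 => /eqP.
Qed.

Lemma dot_le_enorm x y : dot x y <= enorm x * enorm y.
Proof.
have [x0|xn0] := eqVneq (enorm x) 0.
  by rewrite x0 mul0r (enorm0_eq0 x0) -(scale0r 0) dotZl mul0r.
have [y0|yn0] := eqVneq (enorm y) 0.
  by rewrite y0 mulr0 (enorm0_eq0 y0) -(scale0r 0) dotZr mul0r.
have xy_gt0 : 0 < enorm x * enorm y.
  by rewrite mulr_gt0 // lt_def ?xn0 ?yn0 enorm_ge0.
have := dot_ge0 (enorm y *: x - enorm x *: y).
rewrite !dotE (dotC y x) -!sqr_enorm => sq_ge0.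
by rewrite -(ler_pM2l xy_gt0); lra.
Qed.

(** Weighted Young inequality, from |x + a y|^2 >= 0.  It is stated for the
    negated product because the step of the algorithm is a descent step. *)
Lemma dot_young a x y : 0 < a ->
  - (2 * dot x y) <= a^-1 * enorm x ^+ 2 + a * enorm y ^+ 2.
Proof.
move=> a0; rewrite -(ler_pM2l a0) mulrDr mulVKf ?gt_eqF// !sqr_enorm.
have := dot_ge0 (x + a *: y); rewrite !dotE (dotC y x); lra.
Qed.

Lemma enormD x y : enorm (x + y) <= enorm x + enorm y.
Proof.
rewrite -ler_sqr ?nnegrE ?addr_ge0 ?enorm_ge0//.
rewrite sqrrD !sqr_enorm !dotE (dotC y x).
by have := dot_le_enorm x y; lra.
Qed.

Lemma enormZ a x : enorm (a *: x) = `|a| * enorm x.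
Proof.
apply/eqP; rewrite -(@eqrXn2 _ 2) ?mulr_ge0 ?enorm_ge0//.
by rewrite exprMn !sqr_enorm !dotE mulrA -expr2 real_normK ?num_real.
Qed.

Lemma enorm_sum (I : finType) (u : I -> 'rV[R]_d) :
  enorm (\sum_i u i) <= \sum_i enorm (u i).
Proof.
elim/big_ind2 : _ => [|x a y b xa yb|//];
  last by apply: le_trans (enormD _ _) (lerD xa yb).
by rewrite -(scale0r 0) enormZ normr0 mul0r.
Qed.

End Dot.

(** * Smooth functions *)

Section Smooth.
Context {R : realType} {d : nat}.
Implicit Types (g : 'rV[R]_d -> R) (x y h : 'rV[R]_d).

Lemma diff_dot_grad g x h : 'd g x h = dot (grad g x) h.
Proof.
rewrite {1}(row_sum_delta h) linear_sum.
by apply: eq_bigr => j _; rewrite linearZ mxE mulrC.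
Qed.

Lemma is_derive_line g x h (t : R) : differentiable g (x + t *: h) ->
  is_derive t 1 (fun t : R => g (x + t *: h)) (dot (grad g (x + t *: h)) h).
Proof.
move=> dg.
have dl : is_diff t (fun s : R => x + s *: h) (fun s : R => s *: h).
  by apply: is_diff_eq; apply/funext => s /=; rewrite /cst add0r.
have dg' : is_diff (x + t *: h) g ('d g (x + t *: h)) by apply/differentiableP.
have dc := is_diff_comp dl dg'.
have dline : differentiable (g \o (fun s : R => x + s *: h)) t by exact: ex_diff.
apply: DeriveDef; first exact/derivable1_diffP.
rewrite (deriveE _ dline) (@diff_val _ _ _ _ _ _ _ dc) /=.
by rewrite diff_dot_grad scale1r.
Qed.

(** The difference t |-> g (x + t h) - (t <grad g x, h> + t^2 l |h|^2 / 2) has a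
    nonpositive derivative on ]0, 1[, because the gradient moves by at most
    l t |h|; comparing its values at 0 and 1 gives the bound. *)
Lemma smooth_descent (l : R) g x h : smooth l g ->
  g (x + h) <= g x + dot (grad g x) h + l / 2 * enorm h ^+ 2.
Proof.
move=> [dg lip].
pose c1 := dot (grad g x) h; pose c2 := l / 2 * enorm h ^+ 2.
pose phi := fun t : R => g (x + t *: h) - (t * c1 + t ^+ 2 * c2).
pose phi' := fun t : R => dot (grad g (x + t *: h)) h - (c1 + 2 * t * c2).
have phiP (t : R) : is_derive t 1 phi (phi' t).
  have dline := is_derive_line (dg (x + t *: h)).
  apply: is_derive_eq.
  (* Scalings in R, seen as a module over itself, are turned into products. *)
  rewrite !scaler0 !add0r -[t%:A]/(t * 1) -[c1%:A]/(c1 * 1) -[c2 *: _]/(c2 * _).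
  by rewrite /phi' !mulr1 mulrDr; set D := dot _ _; clearbody D c1 c2; lra.
have dphi_le0 (t : R) : t \in `]0, 1[ -> phi^`()%classic t <= 0.
  rewrite in_itv /= => /andP[t0 _].
  rewrite derive1E (@derive_val _ _ _ _ _ _ _ (phiP t)) /phi' /c1 /c2.
  have Hl := lip (x + t *: h) x.
  have xE : x + t *: h - x = t *: h by rewrite addrC addKr.
  rewrite xE enormZ gtr0_norm // in Hl.
  have ub : dot (grad g (x + t *: h) - grad g x) h <= l * (t * enorm h) * enorm h.
    apply: le_trans (dot_le_enorm _ _) _.
    by rewrite ler_wpM2r ?enorm_ge0.
  rewrite dotDl dotNl in ub.
  apply: le_trans (_ : l * (t * enorm h) * enorm h - 2 * t * (l / 2 * enorm h ^+ 2) <= 0).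
    by rewrite opprD addrA lerD2r.
  by rewrite le_eqVlt; apply/orP; left; apply/eqP; field.
have dphi (t : R) : derivable phi t 1 := @ex_derive _ _ _ _ _ _ _ (phiP t).
have cphi : {within `[0, 1], continuous phi}%classic.
  by apply: derivable_within_continuous => t _; exact: dphi.
have := ler0_derive1_le_cc (fun t _ => dphi t) dphi_le0 cphi (x := 1) (y := 0).
rewrite !in_itv /= !lexx ler01 => /(_ isT isT isT).
rewrite /phi scale1r scale0r addr0 expr0n expr1n !mul0r !mul1r addr0 subr0.
by rewrite lerBlDr addrA.
Qed.

End Smooth.

Section AverageSmooth.
Context {R : realType} {n d : nat}.
Implicit Types (f : 'I_n -> 'rV[R]_d -> R) (L : 'I_n -> R).

Let favgE f : favg f = n%:R^-1 \*: \sum_i f i.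
Proof. by apply/funext => x; rewrite /= fct_sumE. Qed.

Lemma differentiable_favg f x :
  (forall i, differentiable (f i) x) -> differentiable (favg f) x.
Proof. by move=> df; rewrite favgE; apply/differentiableZ/differentiable_sum. Qed.

Lemma grad_favg f x :
  (forall i, differentiable (f i) x) -> grad (favg f) x = full_grad f x.
Proof.
move=> df; apply/rowP => j; rewrite /full_grad !mxE.
rewrite -deriveE; last exact: differentiable_favg.
have dv i : derivable (f i) x (delta_mx 0 j) by exact: diff_derivable.
rewrite favgE deriveZ; last exact: derivable_sum.
rewrite derive_sum //; congr (_ * _); rewrite summxE.
by apply: eq_bigr => i _; rewrite mxE deriveE.
Qed.

Lemma smooth_favg f L :
  (forall i, smooth (L i) (f i)) -> smooth (Lbar L) (favg f).
Proof.
move=> smf; have df i x : differentiable (f i) x by case: (smf i).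
split=> [x|x y]; first exact: differentiable_favg.
rewrite !grad_favg // /full_grad -scalerBr -sumrB enormZ ger0_norm ?invr_ge0 //.
rewrite -mulrA ler_wpM2l ?invr_ge0 // mulr_suml.
apply: le_trans (enorm_sum _) _; apply: ler_sum => i _.
by case: (smf i).
Qed.

End AverageSmooth.

(** * Expectation over a finite sample space *)

Section Expectation.
Context {R : realType} {T : finType} (mu : T -> R) (mu_pmf : is_pmf mu).
Implicit Types F G : T -> R.

Lemma Expect_cst a : Expect mu (fun=> a) = a.
Proof. by rewrite /Expect -mulr_suml (proj2 mu_pmf) mul1r. Qed.

Lemma Expect_ext F G : F =1 G -> Expect mu F = Expect mu G.
Proof. by move=> FG; apply: eq_bigr => x _; rewrite FG. Qed.

Lemma ExpectD F G :
  Expect mu (fun x => F x + G x) = Expect mu F + Expect mu G.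
Proof. by rewrite -big_split; apply: eq_bigr => x _; rewrite mulrDr. Qed.

Lemma ExpectZ a F : Expect mu (fun x => a * F x) = a * Expect mu F.
Proof. by rewrite mulr_sumr; apply: eq_bigr => x _; rewrite mulrCA. Qed.

Lemma Expect_sum (I : finType) (F : I -> T -> R) :
  Expect mu (fun x => \sum_i F i x) = \sum_i Expect mu (F i).
Proof. by rewrite exchange_big; apply: eq_bigr => x _; rewrite mulr_sumr. Qed.

Lemma Expect_le F G :
  (forall x, F x <= G x) -> Expect mu F <= Expect mu G.
Proof. by move=> FG; apply: ler_sum => x _; rewrite ler_wpM2l ?(proj1 mu_pmf). Qed.

Lemma ProbE (A : pred T) : Prob mu A = Expect mu (fun x => (A x)%:R).
Proof.
rewrite /Prob big_mkcond; apply: eq_bigr => x _.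
by case: (A x); rewrite ?mulr1 ?mulr0.
Qed.

End Expectation.

(** * Moments of sums over a random set *)

Section SamplingMoments.
Context {R : realType} {n : nat} (q : {set 'I_n} -> R) (q_pmf : is_pmf q).
Implicit Types (z v : 'I_n -> R).

Let sum_in z (A : {set 'I_n}) :
  \sum_(i in A) z i = \sum_i z i * (i \in A)%:R.
Proof.
by rewrite big_mkcond; apply: eq_bigr => i _; case: ifP; rewrite ?mulr1 ?mulr0.
Qed.

Lemma Expect_sum_in z :
  Expect q (fun A => \sum_(i in A) z i) = \sum_i incl_prob q i * z i.
Proof.
rewrite (Expect_ext _ (sum_in z)) Expect_sum.
by apply: eq_bigr => i _; rewrite ExpectZ mulrC /incl_prob ProbE.
Qed.

Lemma avg_sizeE : avg_size q = \sum_i incl_prob q i.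
Proof.
transitivity (Expect q (fun A => \sum_(i in A) 1)).
  by apply: eq_bigr => A _; rewrite sumr_const.
by rewrite Expect_sum_in; apply: eq_bigr => i _; rewrite mulr1.
Qed.

Lemma Expect_sqr_sum_in z :
  Expect q (fun A => (\sum_(i in A) z i) ^+ 2)
  = \sum_i \sum_k prob_mx q i k * z i * z k.
Proof.
have sqE (A : {set 'I_n}) : (\sum_(i in A) z i) ^+ 2
    = \sum_i \sum_k (z i * z k) * ([set i; k] \subset A)%:R.
  rewrite sum_in expr2 mulr_suml; apply: eq_bigr => i _.
  rewrite mulr_sumr; apply: eq_bigr => k _.
  rewrite finset.subUset !finset.sub1set.
  by case: (i \in A); case: (k \in A); rewrite /= ?(mulr0, mul0r, mulr1).
rewrite (Expect_ext _ sqE) Expect_sum; apply: eq_bigr => i _.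
rewrite Expect_sum; apply: eq_bigr => k _.
by rewrite ExpectZ mxE ProbE mulrC mulrA.
Qed.

(** The matrix inequality defining [eso], tested on the vector z.  This is how
    the dependence between the elements of the random set is controlled: second
    moments are bounded as if the indicators were uncorrelated, with
    variances p_i v_i. *)
Lemma eso_quadratic v z : eso q v ->
  \sum_i \sum_k prob_mx q i k * z i * z k
  <= (\sum_i incl_prob q i * z i) ^+ 2 + \sum_i incl_prob q i * v i * z i ^+ 2.
Proof.
move=> [_ /(_ (\col_i z i))].
move=> /le_trans; rewrite -subr_ge0; apply; rewrite le_eqVlt.
apply/orP; left; apply/eqP; rewrite -mulmxA mxE.
transitivity (\sum_i (incl_prob q i * v i * z i ^+ 2
   + incl_prob q i * z i * (\sum_k incl_prob q k * z k)
   - \sum_k prob_mx q i k * z i * z k)); last first.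
  by rewrite sumrB big_split -mulr_suml expr2 /= [X in X - _]addrC.
apply: eq_bigr => i _; rewrite !mxE.
transitivity (\sum_k (z i * ((incl_prob q i * v i) *+ (i == k) * z k)
   + incl_prob q i * z i * (incl_prob q k * z k)
   - prob_mx q i k * z i * z k)).
  rewrite mulr_sumr; apply: eq_bigr => k _; rewrite !mxE big_ord1 !mxE.
  by case: (i == k); rewrite ?mulr1n ?mulr0n; ring.
rewrite sumrB big_split /=; congr (_ + _ - _); last by rewrite -mulr_sumr.
rewrite (bigD1 i) //= eqxx mulr1n big1 ?addr0; first by ring.
by move=> k; rewrite eq_sym => /negPf ->; rewrite mulr0n mul0r mulr0.
Qed.

Lemma incl_prob_le1 i : incl_prob q i <= 1.
Proof.
rewrite /incl_prob ProbE -[leRHS](Expect_cst q_pmf).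
by apply: Expect_le => // A; case: (i \in A).
Qed.

(** Testing the quadratic bound on a basis vector gives v_i >= 1 - p_i. *)
Lemma eso_ge0 v i : proper_sampling q -> eso q v -> 0 <= v i.
Proof.
move=> pq /(@eso_quadratic v (fun k => (k == i)%:R)).
have sum_delta (F : 'I_n -> R) : \sum_k F k * (k == i)%:R = F i.
  rewrite (bigD1 i) //= eqxx mulr1 big1 ?addr0// => k /negPf ->.
  by rewrite mulr0.
under eq_bigr do rewrite sum_delta.
rewrite !sum_delta; under [X in _ <= _ + X]eq_bigr => k _.
  rewrite expr2 mulrA mulrAC; over.
rewrite /= !sum_delta eqxx mulr1.
have -> : prob_mx q i i = incl_prob q i.
  by rewrite mxE /incl_prob /Prob; apply: eq_bigl => A;
    rewrite finset.setUid finset.sub1set.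
move=> H; have p0 := pq i; have := incl_prob_le1 i => p1.
rewrite -(pmulr_rge0 _ p0); nra.
Qed.

End SamplingMoments.

(** * Importance-weighted estimators *)

Section WeightedEstimator.
Context {R : realType} {n d : nat} (q : {set 'I_n} -> R).
Hypothesis q_pmf : is_pmf q.
Hypothesis q_proper : proper_sampling q.
Implicit Types (u : 'I_n -> 'rV[R]_d) (g y : 'rV[R]_d) (v : 'I_n -> R).

(** The form of the SVRG direction, with u_i the gradient differences and g the
    full gradient at the snapshot: each term is divided by its inclusion
    probability, which makes the sum over the random set unbiased. *)
Definition weighted_est u g (A : {set 'I_n}) : 'rV[R]_d :=
  \sum_(i in A) (n%:R * incl_prob q i)^-1 *: u i + g.

Definition mean_est u g : 'rV[R]_d := n%:R^-1 *: \sum_i u i + g.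

Let pw i : incl_prob q i * (n%:R * incl_prob q i)^-1 = n%:R^-1.
Proof. by rewrite invfM mulrCA divff ?mulr1 ?gt_eqF ?q_proper. Qed.

Lemma Expect_weighted_est u g y :
  Expect q (fun A => dot (weighted_est u g A) y) = dot (mean_est u g) y.
Proof.
have estE (A : {set 'I_n}) : dot (weighted_est u g A) y
    = \sum_(i in A) (n%:R * incl_prob q i)^-1 * dot (u i) y + dot g y.
  by rewrite dotDl dot_suml; congr (_ + _); apply: eq_bigr => i _; rewrite dotZl.
rewrite (Expect_ext _ estE) ExpectD (Expect_cst q_pmf) Expect_sum_in.
under eq_bigr do rewrite mulrA pw.
by rewrite -mulr_sumr dotDl dotZl dot_suml.
Qed.

(** Bias-variance decomposition, coordinate by coordinate: the square of the
    mean reassembles from the first moments, and [eso_quadratic] bounds what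
    remains. *)
Lemma Expect_sqr_weighted_est v u g : eso q v ->
  Expect q (fun A => enorm (weighted_est u g A) ^+ 2)
  <= enorm (mean_est u g) ^+ 2
     + n%:R^-1 ^+ 2 * \sum_i v i / incl_prob q i * enorm (u i) ^+ 2.
Proof.
move=> ev; pose z j i := (n%:R * incl_prob q i)^-1 * u i 0 j.
have mean j : \sum_i incl_prob q i * z j i + g 0 j = mean_est u g 0 j.
  under eq_bigr do rewrite mulrA pw.
  by rewrite -mulr_sumr !mxE summxE.
have coord j : Expect q (fun A => weighted_est u g A 0 j ^+ 2)
    <= mean_est u g 0 j ^+ 2 + \sum_i incl_prob q i * v i * z j i ^+ 2.
  have estE (A : {set 'I_n}) : weighted_est u g A 0 j ^+ 2
      = (\sum_(i in A) z j i) ^+ 2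
        + (2 * g 0 j * (\sum_(i in A) z j i) + g 0 j ^+ 2).
    rewrite mxE summxE (_ : \sum_(i in A) _ = \sum_(i in A) z j i); first by ring.
    by apply: eq_bigr => i _; rewrite mxE.
  rewrite (Expect_ext _ estE) !ExpectD ExpectZ (Expect_cst q_pmf).
  rewrite Expect_sum_in Expect_sqr_sum_in -mean.
  have shift (Q S D c : R) :
      Q <= S ^+ 2 + D -> Q + (2 * c * S + c ^+ 2) <= (S + c) ^+ 2 + D by lra.
  exact/shift/eso_quadratic.
have sqE (A : {set 'I_n}) :
    enorm (weighted_est u g A) ^+ 2 = \sum_j weighted_est u g A 0 j ^+ 2.
  by rewrite sqr_enorm; apply: eq_bigr => j _; rewrite expr2.
rewrite (Expect_ext _ sqE) Expect_sum.
apply: le_trans (ler_sum _ (fun j _ => coord j)) _.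
rewrite big_split /= sqr_enorm lerD //.
rewrite exchange_big mulr_sumr /=; apply: ler_sum => i _.
rewrite sqr_enorm !mulr_sumr; apply: ler_sum => j _.
have p0 : incl_prob q i != 0 by rewrite gt_eqF ?q_proper.
rewrite /z exprMn invfM -expr2 exprMn.
set a := n%:R^-1 ^+ 2; rewrite le_eqVlt; apply/orP; left; apply/eqP.
by field.
Qed.

End WeightedEstimator.

(** * Decrease of the potential in one step *)

Section PotentialStep.
Context {R : realType} {d : nat} {T : finType} (mu : T -> R).
Context (F : 'rV[R]_d -> R) (x y G : 'rV[R]_d) (dir : T -> 'rV[R]_d).

(** One stochastic step from x, with y the snapshot and G the gradient at x.
    Expanding both squares leaves an affine function of the direction plus a
    multiple of its square, so that only its first two moments matter; the
    remaining cross term <G, x - y> is split by Young's inequality. *)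
Lemma potential_step (l V eta beta c : R) :
  is_pmf mu ->
  (forall h, F (x + h) <= F x + dot G h + l / 2 * enorm h ^+ 2) ->
  (forall u, Expect mu (fun a => dot (dir a) u) = dot G u) ->
  Expect mu (fun a => enorm (dir a) ^+ 2)
    <= enorm G ^+ 2 + V * enorm (x - y) ^+ 2 ->
  0 <= l -> 0 <= eta -> 0 < beta -> 0 <= c ->
  Expect mu (fun a => F (x - eta *: dir a)
                      + c * enorm (x - eta *: dir a - y) ^+ 2)
  <= F x + (c * (1 + eta * beta + eta ^+ 2 * V) + l / 2 * eta ^+ 2 * V)
           * enorm (x - y) ^+ 2
     - (eta - c * eta / beta - (l / 2 + c) * eta ^+ 2) * enorm G ^+ 2.
Proof.
move=> mu_pmf descent unbiased second l0 eta0 beta0 c0.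
pose u := G + (2 * c) *: (x - y); pose k := (l / 2 + c) * eta ^+ 2.
(* The part of the bound that depends on the draw, grouped as a linear form
   plus a quadratic one. *)
have pointwise a : F (x - eta *: dir a) + c * enorm (x - eta *: dir a - y) ^+ 2
    <= (F x + c * enorm (x - y) ^+ 2)
       + (- eta * dot (dir a) u + k * enorm (dir a) ^+ 2).
  have := descent (- (eta *: dir a)).
  rewrite (addrAC x _ (- y)) !sqr_enorm /u /k; move: (x - y) (dir a) => e w.
  rewrite !dotE (dotC G w) (dotC e w).
  move: (F _) (F x) (dot w w) (dot w e) (dot w G) (dot e e) => f' f0 ww we wG ee.
  lra.
apply: le_trans (Expect_le mu_pmf pointwise) _.
rewrite ExpectD (Expect_cst mu_pmf) ExpectD !ExpectZ unbiased /u.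
have k0 : 0 <= k by rewrite mulr_ge0 ?sqr_ge0// addr_ge0// divr_ge0.
have := ler_wpM2l k0 second.
have := ler_wpM2l (mulr_ge0 c0 eta0) (dot_young G (x - y) beta0).
rewrite (dotDr G) (dotZr (2 * c)) -sqr_enorm /k.
move: (F x) (dot G _) (enorm G ^+ 2) (enorm (x - y) ^+ 2) (Expect _ _).
move=> f0 GE GG EE X; lra.
Qed.

End PotentialStep.

(** * Moments of the SVRG direction *)

Section SvrgStep.
Context {R : realType} {n d : nat}.
Implicit Types (f : 'I_n -> 'rV[R]_d -> R) (L v : 'I_n -> R).
Context (q : {set 'I_n} -> R).
Hypothesis q_pmf : is_pmf q.
Hypothesis q_proper : proper_sampling q.

Lemma avg_size_gt0 : (0 < n)%N -> 0 < avg_size q.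
Proof.
move=> n0; rewrite avg_sizeE (bigD1 (Ordinal n0)) //=.
by rewrite ltr_pwDl ?q_proper// sumr_ge0// => i _; apply/ltW/q_proper.
Qed.

Lemma mean_svrg_dir f xt x :
  mean_est (fun i => grad (f i) x - grad (f i) xt) (full_grad f xt)
  = full_grad f x.
Proof.
rewrite /mean_est /full_grad -scalerDr -big_split; congr (_ *: _).
by apply: eq_bigr => i _; rewrite /= subrK.
Qed.

Lemma Expect_svrg_dir f xt x y :
  Expect q (fun A => dot (svrg_dir q f xt x A) y) = dot (full_grad f x) y.
Proof. by rewrite -(mean_svrg_dir f xt x) -(Expect_weighted_est q_pmf q_proper). Qed.

(** The variance vanishes as the iterate approaches the snapshot, by
    smoothness of each f_i: this is the variance reduction. *)
Lemma Expect_sqr_svrg_dir f L v xt x :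
  (forall i, smooth (L i) (f i)) -> eso q v -> (0 < n)%N ->
  Expect q (fun A => enorm (svrg_dir q f xt x A) ^+ 2)
  <= enorm (full_grad f x) ^+ 2
     + Kconst q v L / avg_size q * enorm (x - xt) ^+ 2.
Proof.
move=> smf ev n0.
have := Expect_sqr_weighted_est q_pmf q_proper
  (fun i => grad (f i) x - grad (f i) xt) (full_grad f xt) ev.
rewrite mean_svrg_dir => /le_trans; apply; rewrite lerD2l.
have -> : Kconst q v L / avg_size q
    = n%:R^-1 ^+ 2 * \sum_i v i / incl_prob q i * L i ^+ 2.
  have b0 := gt_eqF (avg_size_gt0 n0).
  rewrite /Kconst mulrAC (mulrAC (avg_size q)) divff ?b0// mul1r exprVn.
  by congr (_ * _); apply: eq_bigr => i _; rewrite mulrAC.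
rewrite -[leRHS]mulrA ler_wpM2l ?sqr_ge0// mulr_suml; apply: ler_sum => i _.
rewrite -[leRHS]mulrA ler_wpM2l//.
  apply: divr_ge0; first exact: (eso_ge0 q_pmf _ q_proper ev).
  exact/ltW/q_proper.
rewrite -exprMn; have lip := (proj2 (smf i)) x xt.
by rewrite ler_sqr ?nnegrE ?enorm_ge0// (le_trans _ lip) ?enorm_ge0.
Qed.

End SvrgStep.

(** * Redrawing one entry of an independent table *)

Section Redraw.
Context {R : realType} {I T : finType} (mu : T -> R).

Definition redraw (w : {ffun I -> T}) (i : I) (a : T) : {ffun I -> T} :=
  [ffun j => if j == i then a else w j].

(** Exchanging the entry i of the table with an independent draw is an
    involution that preserves the product law.  Taking the expectation over the
    new entry first plays the role of conditioning on all the other entries. *)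
Lemma Expect_redraw i (G : {ffun I -> T} -> R) : is_pmf mu ->
  Expect (iid_pmf mu) (fun w => Expect mu (fun a => G (redraw w i a)))
  = Expect (iid_pmf mu) G.
Proof.
move=> mu_pmf.
pose swap (z : {ffun I -> T} * T) := (redraw z.1 i z.2, z.1 i).
have redrawK w a : redraw (redraw w i a) i (w i) = w.
  by apply/ffunP => j; rewrite !ffunE; case: eqP => // ->.
have swapK : involutive swap.
  by move=> [w a]; rewrite /swap /= redrawK ffunE eqxx.
have swap_pmf w a : iid_pmf mu (redraw w i a) * mu (w i) = iid_pmf mu w * mu a.
  rewrite /iid_pmf (bigD1 i) //= [in RHS](bigD1 i) //= ffunE eqxx mulrAC.
  rewrite [in RHS]mulrAC (mulrC (mu a)); congr (_ * _).
  by apply: eq_bigr => j /negPf ji; rewrite ffunE ji.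
transitivity (\sum_z iid_pmf mu z.1 * mu z.2 * G (redraw z.1 i z.2)).
  rewrite -(pair_bigA _ (fun w a => iid_pmf mu w * mu a * G (redraw w i a))) /=.
  apply: eq_bigr => w _; rewrite mulr_sumr.
  by apply: eq_bigr => a _; rewrite mulrA.
rewrite (reindex_inj (inv_inj swapK)) /=.
rewrite -(pair_bigA _ (fun w a => iid_pmf mu (redraw w i a) * mu (w i)
                                  * G (redraw (redraw w i a) i (w i)))) /=.
apply: eq_bigr => w _; under eq_bigr do rewrite swap_pmf redrawK mulrAC.
by rewrite -mulr_sumr (proj2 mu_pmf) mulr1.
Qed.

End Redraw.

(** * Telescoping over a run *)

Section Run.
Context {R : realType} {n d : nat}.
Context (q : {set 'I_n} -> R) (f : 'I_n -> 'rV[R]_d -> R).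
Context (eta : R) (x0 : 'rV[R]_d) (M m : nat).

Local Notation inner := (inner q f eta).
Local Notation snapshot := (snapshot q f eta x0 m).
Local Notation iterate := (iterate q f eta x0 m).
Local Notation table := {ffun 'I_M * 'I_m -> {set 'I_n}}.

Lemma inner_ext xt St St' t :
  (forall t', (t' < t)%N -> St t' = St' t') -> inner xt St t = inner xt St' t.
Proof.
elim: t => [//|t IH] eqS.
have eqt : inner xt St t = inner xt St' t by apply: IH => t' t't; exact/eqS/ltnW.
by rewrite /= eqt (eqS t (ltnSn t)).
Qed.

Lemma snapshot_ext S S' s :
  (forall s' t, (s' < s)%N -> (t < m)%N -> S s' t = S' s' t) ->
  snapshot S s = snapshot S' s.
Proof.
elim: s => [//|s IH] eqS.
have eqs : snapshot S s = snapshot S' s.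
  by apply: IH => s' t s's; exact/eqS/ltnW.
by rewrite /= eqs; apply: inner_ext => t; exact: eqS.
Qed.

Lemma iterateS S s t : iterate S s t.+1
  = iterate S s t - eta *: svrg_dir q f (snapshot S s) (iterate S s t) (S s t).
Proof. by []. Qed.

Lemma draws_redraw (w : table) (i : 'I_M) (j : 'I_m) a s t :
  draws (redraw w (i, j) a) s t = if (s == i) && (t == j) then a else draws w s t.
Proof.
rewrite /draws; case: insubP => [i' _ <-|]; last first.
  by case: eqP => // ->; rewrite ltn_ord.
case: insubP => [j' _ <-|]; last first.
  by rewrite andbC; case: eqP => // ->; rewrite ltn_ord.
by rewrite ffunE xpair_eqE.
Qed.

(** Adaptedness: a draw does not influence what was computed before it. *)
Lemma snapshot_redraw (w : table) (i : 'I_M) (j : 'I_m) a :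
  snapshot (draws (redraw w (i, j) a)) i = snapshot (draws w) i.
Proof.
by apply: snapshot_ext => s' t /ltn_eqF s'i _; rewrite draws_redraw s'i.
Qed.

Lemma iterate_redraw (w : table) (i : 'I_M) (j : 'I_m) a :
  iterate (draws (redraw w (i, j) a)) i j = iterate (draws w) i j.
Proof.
rewrite /iterate snapshot_redraw; apply: inner_ext => t /ltn_eqF tj.
by rewrite draws_redraw tj andbF.
Qed.

Lemma iterateS_redraw (w : table) (i : 'I_M) (j : 'I_m) a (x := iterate (draws w) i j) :
  iterate (draws (redraw w (i, j) a)) i j.+1
  = x - eta *: svrg_dir q f (snapshot (draws w) i) x a.
Proof.
rewrite iterateS iterate_redraw snapshot_redraw.
by rewrite draws_redraw !eqxx.
Qed.

Hypothesis q_pmf : is_pmf q.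
Context (c : nat -> R) (gamma : R) (xstar : 'rV[R]_d).
Hypothesis gamma_gt0 : 0 < gamma.
Hypothesis c_m : c m = 0.
Hypothesis xstar_min : forall x, favg f xstar <= favg f x.
Hypothesis step : forall xt x t, (t < m)%N ->
  Expect q (fun A => favg f (x - eta *: svrg_dir q f xt x A)
             + c t.+1 * enorm (x - eta *: svrg_dir q f xt x A - xt) ^+ 2)
  <= favg f x + c t * enorm (x - xt) ^+ 2 - gamma * enorm (grad (favg f) x) ^+ 2.

Local Notation E := (Expect (iid_pmf q)).
Let iid := iid_pmfP ('I_M * 'I_m)%type q_pmf.

Let sqg s t (w : table) : R := enorm (grad (favg f) (iterate (draws w) s t)) ^+ 2.
Let fs s (w : table) : R := favg f (snapshot (draws w) s).
Let phi s t (w : table) : R := favg f (iterate (draws w) s t)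
  + c t * enorm (iterate (draws w) s t - snapshot (draws w) s) ^+ 2.

Let phi_step (i : 'I_M) (j : 'I_m) :
  E (phi i j.+1) + gamma * E (sqg i j) <= E (phi i j).
Proof.
rewrite -(Expect_redraw (i, j) (phi i j.+1) q_pmf) -ExpectZ -ExpectD.
apply: Expect_le => // w; rewrite -lerBrDr.
under Expect_ext => a do rewrite /phi iterateS_redraw snapshot_redraw.
exact: step.
Qed.

(** Both ends of an epoch lose the quadratic term of the potential: at t = 0 the
    iterate is the snapshot, at t = m the weight is zero. *)
Let epoch (i : 'I_M) :
  gamma * \sum_(j < m) E (sqg i j) <= E (fs i) - E (fs i.+1).
Proof.
have telescope t : (t <= m)%N ->
    gamma * \sum_(j < t) E (sqg i j) <= E (phi i 0) - E (phi i t).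
  elim: t => [|t IH] tm; first by rewrite big_ord0 mulr0 subrr.
  rewrite big_ord_recr /= mulrDr.
  have := IH (ltnW tm); have := phi_step i (Ordinal tm) => /=; lra.
have -> : E (fs i) = E (phi i 0).
  apply: Expect_ext => w; rewrite /phi /fs /iterate /= subrr.
  by rewrite -(scale0r 0) enormZ normr0 mul0r expr0n mulr0 addr0.
have -> : E (fs i.+1) = E (phi i m).
  by apply: Expect_ext => w; rewrite /phi /fs c_m mul0r addr0.
exact: telescope.
Qed.

Let run_sum :
  gamma * \sum_(i < M) \sum_(j < m) E (sqg i j) <= favg f x0 - favg f xstar.
Proof.
have telescope s : (s <= M)%N ->
    gamma * \sum_(i < s) \sum_(j < m) E (sqg i j) <= favg f x0 - E (fs s).
  elim: s => [|s IH] sM.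
    by rewrite big_ord0 mulr0 [E (fs 0)](Expect_cst iid (favg f x0)) subrr.
  rewrite big_ord_recr /= mulrDr.
  have := IH (ltnW sM); have := epoch (Ordinal sM) => /=; lra.
apply: le_trans (telescope M (leqnn M)) _; rewrite lerD2l lerN2.
rewrite -(Expect_cst iid (favg f xstar)).
by apply: (Expect_le iid) => w; exact: xstar_min.
Qed.

(** The output index is uniform, so the expectation is the average over all
    iterates of the quantity bounded by the telescoping sum. *)
Lemma Expect_output_sqr_grad : (0 < M * m)%N ->
  Expect (@run_pmf R n q m M)
    (fun o => enorm (grad (favg f) (svrg_output q f eta x0 o)) ^+ 2)
  <= (favg f x0 - favg f xstar) / (gamma * (M * m)%:R).
Proof.
move=> Mm; have -> : Expect (@run_pmf R n q m M)
    (fun o => enorm (grad (favg f) (svrg_output q f eta x0 o)) ^+ 2)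
  = (M * m)%:R^-1 * \sum_(i < M) \sum_(j < m) E (sqg i j).
  rewrite (pair_bigA _ (fun (i : 'I_M) (j : 'I_m) => E (sqg i j))) -Expect_sum.
  rewrite -ExpectZ /=.
  rewrite /Expect -(pair_bigA _ (fun w (ij : 'I_M * 'I_m) =>
    run_pmf q (w, ij) * sqg ij.1 ij.2 w)) /=.
  apply: eq_bigr => w _; rewrite mulrA mulr_sumr; apply: eq_bigr => ij _.
  by rewrite /run_pmf /prod_pmf /uniform_pmf card_prod !card_ord.
rewrite invfM mulrA [leRHS]mulrC ler_wpM2l ?invr_ge0// ler_pdivlMr// [leLHS]mulrC.
exact: run_sum.
Qed.

End Run.

(** * The choice of constants *)

Section Constants.
Context {R : realType}.
Context (l k r : R) (m : nat).
Hypotheses (l_gt0 : 0 < l) (k_ge1 : 1 <= k) (r_gt0 : 0 < r) (r_le1 : r <= 1).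
Hypothesis m_le : m%:R * r <= 4 / 3 * k.

Local Notation eta := (r / (4 * l)).
Local Notation beta := (l / k).
Local Notation V := (l ^+ 2 / (r * k ^+ 2)).

(** Twice the solution l eta^2 V / 2 * (m - t) of the recursion without the
    growth factor 1 + eta beta + eta^2 V.  That factor exceeds 1 by at most
    (5/12) / m, so that doubling the slope absorbs it. *)
Definition potential_weight (t : nat) : R :=
  l * r / (16 * k ^+ 2) * (m%:R - t%:R).

Let k_gt0 : 0 < k. Proof. exact: lt_le_trans ltr01 k_ge1. Qed.

Let k_ge0 : 0 <= k. Proof. exact: ltW. Qed.
Let l_ge0 : 0 <= l. Proof. exact: ltW. Qed.
Let r_ge0 : 0 <= r. Proof. exact: ltW. Qed.

Lemma potential_weight_ge0 t : (t <= m)%N -> 0 <= potential_weight t.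
Proof.
move=> tm; rewrite mulr_ge0 ?subr_ge0 ?ler_nat//.
by rewrite divr_ge0 ?mulr_ge0.
Qed.

Let weight_le t : potential_weight t <= l / (12 * k).
Proof.
apply: le_trans (_ : l / (16 * k ^+ 2) * (m%:R * r) <= _).
  rewrite /potential_weight.
  have -> : l * r / (16 * k ^+ 2) * (m%:R - t%:R)
     = l / (16 * k ^+ 2) * (m%:R * r - t%:R * r) by field; rewrite gt_eqF.
  rewrite ler_wpM2l ?divr_ge0 ?mulr_ge0//.
  by rewrite gerBl mulr_ge0.
apply: le_trans (_ : l / (16 * k ^+ 2) * (4 / 3 * k) <= _).
  by rewrite ler_wpM2l ?divr_ge0 ?mulr_ge0.
by rewrite le_eqVlt; apply/orP; left; apply/eqP; field; rewrite gt_eqF.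
Qed.

Lemma potential_weight_rec t : (t < m)%N ->
  potential_weight t.+1 * (1 + eta * beta + eta ^+ 2 * V)
  + l / 2 * eta ^+ 2 * V <= potential_weight t.
Proof.
move=> tm; pose j : R := m%:R - t.+1%:R; pose A := l * r / (32 * k ^+ 2).
have j_ge0 : 0 <= j by rewrite subr_ge0 ler_nat.
have jr : j * r <= 4 / 3 * k.
  apply: le_trans m_le; rewrite ler_wpM2r//.
  by rewrite gerBl.
have A_ge0 : 0 <= A by rewrite divr_ge0 ?mulr_ge0.
have -> : l / 2 * eta ^+ 2 * V = A.
  by rewrite /A; field; rewrite !gt_eqF.
have -> : potential_weight t.+1 = 2 * A * j.
  by rewrite /potential_weight /A /j; field; rewrite gt_eqF.
have -> : potential_weight t = 2 * A * (j + 1).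
  by rewrite /potential_weight /A /j -(natr1 t); field; rewrite gt_eqF.
pose th := eta * beta + eta ^+ 2 * V.
(* (4/3) * (1/4 + 1/16) = 5/12: the first factor bounds m r / k, the second
   bounds th * k / r since k >= 1. *)
have th_le : j * th <= 1 / 2.
  apply: le_trans (_ : j * (5 / 16 * r / k) <= _); last first.
    have -> : j * (5 / 16 * r / k) = 5 / 16 / k * (j * r).
      by field; rewrite gt_eqF.
    apply: le_trans (_ : 5 / 16 / k * (4 / 3 * k) <= _).
      by rewrite ler_wpM2l ?divr_ge0.
    have -> : 5 / 16 / k * (4 / 3 * k) = 5 / 12 :> R by field; rewrite gt_eqF.
    lra.
  rewrite ler_wpM2l//.
  have -> : th = r / k * (1 / 4 + 1 / 16 * k^-1).
    by rewrite /th; field; rewrite !gt_eqF.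
  have -> : 5 / 16 * r / k = r / k * (1 / 4 + 1 / 16) by field; rewrite gt_eqF.
  rewrite ler_wpM2l ?divr_ge0// lerD2l ler_piMr ?invf_le1//; lra.
have -> : 2 * A * j * (1 + eta * beta + eta ^+ 2 * V) + A
  = 2 * A * j + A + 2 * A * (j * th) by rewrite /th; ring.
have -> : 2 * A * (j + 1) = 2 * A * j + A + 2 * A * (1 / 2) by field.
by rewrite lerD2l ler_wpM2l // mulr_ge0.
Qed.

(** The three losses, relative to eta, are at most 1/12, 1/8 and 1/48, whose sum
    is below 1/2. *)
Lemma potential_weight_gain t : (t <= m)%N ->
  eta / 2 <= eta - potential_weight t * eta / beta
             - (l / 2 + potential_weight t) * eta ^+ 2.
Proof.
move=> tm; set c := potential_weight t.
have c_ge0 : 0 <= c by exact: potential_weight_ge0.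
have eta_gt0 : 0 < eta by rewrite divr_gt0 ?mulr_gt0//.
have cb : c / beta <= 1 / 12.
  rewrite ler_pdivrMr ?divr_gt0//; apply: le_trans (weight_le t) _.
  by rewrite le_eqVlt; apply/orP; left; apply/eqP; field; rewrite gt_eqF.
have le_eta : l * eta <= 1 / 4.
  have -> : l * eta = r / 4 by field; rewrite gt_eqF.
  by rewrite ler_pM2r.
have ce : c * eta <= 1 / 48.
  apply: le_trans (_ : l / 12 * eta <= _); last lra.
  rewrite ler_wpM2r ?(ltW eta_gt0)//; apply: le_trans (weight_le t) _.
  rewrite ler_wpM2l// lef_pV2 ?posrE ?mulr_gt0//.
  by rewrite -[leLHS]mulr1 ler_pM2l.
have -> : eta - c * eta / beta - (l / 2 + c) * eta ^+ 2
  = eta * (1 - c / beta - (l * eta / 2 + c * eta)) by ring.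
rewrite ler_wpM2l ?(ltW eta_gt0)//; lra.
Qed.

End Constants.

Lemma outer_loopsM {R : realType} (m M : nat) :
  (0 < m)%N -> @outer_loops R m (M * m) = M.
Proof.
move=> m0; rewrite /outer_loops natrM mulfK ?pnatr_eq0 -?lt0n//.
by rewrite -[M%:R]/(M%:Z%:~R) intrKceil.
Qed.

(** Lets n^(2/3) and n be treated as the polynomials k^2 and k^3. *)
Lemma cube_root_nat {R : realType} (n : nat) : (0 < n)%N ->
  exists2 k : R, 1 <= k & n%:R `^ (2 / 3) = k ^+ 2 /\ n%:R = k ^+ 3.
Proof.
move=> n0; pose k : R := n%:R `^ 3^-1.
have k3 : n%:R = k ^+ 3.
  by rewrite -powR_mulrn ?powR_ge0// -powRrM mulVf ?powRr1.
exists k; last by split=> //; rewrite mulrC powRrM powR_mulrn ?powR_ge0.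
by rewrite -(@expr_ge1 _ 3) ?powR_ge0// -k3 ler1n.
Qed.

(** * Convergence rate and evaluation count *)

Section Rate.
Context {R : realType} {n d : nat}.
Context (f : 'I_n -> 'rV[R]_d -> R) (L v : 'I_n -> R) (q : {set 'I_n} -> R).
Context (xstar x0 : 'rV[R]_d).
Hypothesis smf : forall i, smooth (L i) (f i).
Hypothesis xstar_min : forall x, favg f xstar <= favg f x.
Hypothesis q_pmf : is_pmf q.
Hypothesis q_proper : proper_sampling q.
Hypothesis ev : eso q v.
Hypothesis l_gt0 : 0 < Lbar L.

Local Notation b := (avg_size q).
Local Notation a := (alpha q v L).
Local Notation l := (Lbar L).
Local Notation n23 := (n%:R `^ (2 / 3)).
Local Notation gap := (favg f x0 - favg f xstar).

Lemma card_gt0_of_Lbar : (0 < n)%N.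
Proof.
rewrite lt0n; apply/eqP => n0; have n'0 : n%:R^-1 = 0 :> R by rewrite n0 invr0.
by move: l_gt0; rewrite /Lbar n'0 mul0r ltxx.
Qed.

Hypothesis b_le : b <= a * n23.
Context (m : nat).
Hypothesis m_le : m%:R <= n%:R * a / (3 * b * 4^-1).
Hypothesis m_gt0 : (0 < m)%N.

Lemma alpha_gt0 : 0 < a.
Proof.
have := lt_le_trans (avg_size_gt0 q_proper card_gt0_of_Lbar) b_le.
by rewrite pmulr_lgt0// powR_gt0 // ltr0n card_gt0_of_Lbar.
Qed.

Lemma svrg_rate T : (0 < T)%N -> (m %| T)%N ->
  svrg_sq_grad q f (4^-1 * b / (a * l * n23)) x0 m T
  <= 8 * (a * l * n23 * gap) / (b * T%:R).
Proof.
move=> T_gt0 /dvdnP[M TE]; rewrite TE in T_gt0 *.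
have b_gt0 := avg_size_gt0 q_proper card_gt0_of_Lbar.
have a_gt0 := alpha_gt0.
have [k k_ge1 [n23E nE]] := cube_root_nat (R := R) card_gt0_of_Lbar.
have k_gt0 : 0 < k by exact: lt_le_trans ltr01 k_ge1.
rewrite n23E; move: b_le m_le; rewrite n23E nE => b_le' m_le'.
pose r := b / (a * k ^+ 2).
have ak2_gt0 : 0 < a * k ^+ 2 by apply: mulr_gt0 => //; exact: exprn_gt0.
have r_gt0 : 0 < r by exact: divr_gt0.
have r_le1 : r <= 1 by rewrite ler_pdivrMr ?mul1r.
have mr_le : m%:R * r <= 4 / 3 * k.
  have -> : 4 / 3 * k = k ^+ 3 * a / (3 * b * 4^-1) * r.
    by rewrite /r; field; rewrite !gt_eqF.
  by rewrite ler_wpM2r// ltW.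
have etaE : 4^-1 * b / (a * l * k ^+ 2) = r / (4 * l).
  by rewrite /r; field; rewrite !gt_eqF.
have VE : Kconst q v L / b = l ^+ 2 / (r * k ^+ 2).
  have -> : Kconst q v L = a * l ^+ 2.
    by rewrite /alpha mulfVK// expf_eq0 /= gt_eqF.
  by rewrite /r; field; rewrite !gt_eqF.
rewrite etaE; set eta := r / (4 * l).
have eta_gt0 : 0 < eta by apply: divr_gt0 => //; exact: mulr_gt0.
have smF := smooth_favg smf.
have step xt x t : (t < m)%N ->
  Expect q (fun A => favg f (x - eta *: svrg_dir q f xt x A)
     + potential_weight l k r m t.+1
       * enorm (x - eta *: svrg_dir q f xt x A - xt) ^+ 2)
  <= favg f x + potential_weight l k r m t * enorm (x - xt) ^+ 2
     - eta / 2 * enorm (grad (favg f) x) ^+ 2.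
  move=> tm.
  have df i : differentiable (f i) x by case: (smf i).
  have descent h := smooth_descent x h smF; rewrite grad_favg// in descent *.
  have second := Expect_sqr_svrg_dir q_pmf q_proper xt x smf ev card_gt0_of_Lbar.
  rewrite VE in second.
  have c_ge0 := potential_weight_ge0 l_gt0 k_ge1 r_gt0 tm.
  have := potential_step q_pmf descent (Expect_svrg_dir q_pmf q_proper f xt x)
    second (ltW l_gt0) (ltW eta_gt0) (divr_gt0 l_gt0 k_gt0) c_ge0.
  move=> /le_trans; apply; apply: lerB.
    rewrite lerD2l ler_wpM2r ?sqr_ge0//.
    exact: potential_weight_rec.
  rewrite ler_wpM2r ?sqr_ge0//.
  exact: potential_weight_gain.
have c_m : potential_weight l k r m m = 0 by rewrite /potential_weight subrr mulr0.
have eta2_gt0 : 0 < eta / 2 by rewrite divr_gt0.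
rewrite /svrg_sq_grad outer_loopsM//.
apply: le_trans (Expect_output_sqr_grad x0 q_pmf eta2_gt0 c_m xstar_min step T_gt0) _.
rewrite le_eqVlt; apply/orP; left; apply/eqP; rewrite /eta /r.
have M_gt0 : (0 < M)%N by move: T_gt0; rewrite muln_gt0 => /andP[].
by field; rewrite !gt_eqF ?ltr0n.
Qed.

(** Converts a number of evaluations into a number of iterations.  As m is at
    least half of the real number that it rounds, n / m is at most
    (3/2) b / alpha, so that T iterations cost at most
    T b (1 + 3 / (2 alpha)) evaluations.  The constant 12 is half of
    mu2 / nu2 = 24, since rounding the number of epochs down may waste half of
    the budget. *)
Lemma svrg_accurate_of_evals eps T : (0 < T)%N -> (m %| T)%N ->
  n%:R * a / (3 * b * 4^-1) <= 2 * m%:R -> 0 < eps ->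
  12 * (l * n23 * gap / eps) * (1 + 4 / 3 * a) <= svrg_evals q m T ->
  svrg_accurate q f (4^-1 * b / (a * l * n23)) x0 m T eps.
Proof.
move=> T_gt0 mT m_ge eps_gt0.
have b_gt0 := avg_size_gt0 q_proper card_gt0_of_Lbar.
have a_gt0 := alpha_gt0.
have mR_gt0 : 0 < m%:R :> R by rewrite ltr0n.
have TR_gt0 : 0 < T%:R :> R by rewrite ltr0n.
have evalsE : svrg_evals q m T = T%:R * (n%:R / m%:R + b).
  have [M TE] := dvdnP mT.
  rewrite /svrg_evals TE outer_loopsM// natrM -mulrA; congr (_ * _).
  by field; rewrite gt_eqF.
rewrite evalsE => evals_ge.
apply: le_trans (svrg_rate T_gt0 mT) _.
have nm : n%:R / m%:R <= 3 / 2 * b / a.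
  rewrite ler_pdivrMr// mulrAC ler_pdivlMr//.
  have b34_gt0 : 0 < 3 * b * 4^-1 by rewrite pmulr_lgt0// pmulr_rgt0.
  by move: m_ge; rewrite ler_pdivrMr// => /le_trans; apply; lra.
pose W := l * n23 * gap / eps.
have W_le : 8 * W <= T%:R * b / a.
  have a34_gt0 : 0 < 2 * (a + 3 / 4) by lra.
  rewrite -(ler_pM2r a34_gt0).
  apply: le_trans (_ : T%:R * (n%:R / m%:R + b) <= _).
    by apply: le_trans evals_ge; rewrite -/W; lra.
  apply: le_trans (_ : T%:R * (3 / 2 * b / a + b) <= _).
    by rewrite ler_wpM2l// lerD2r.
  have -> : T%:R * (3 / 2 * b / a + b) = T%:R * b / a * (a + 3 / 2).
    by field; rewrite gt_eqF.
  rewrite ler_wpM2l//; last lra.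
  by apply: divr_ge0; [apply: mulr_ge0 => //; exact: ltW | exact: ltW].
have -> : a * l * n23 * gap = a * eps * W by rewrite /W; field; rewrite gt_eqF.
rewrite ler_pdivrMr; last exact: mulr_gt0.
have -> : 8 * (a * eps * W) = eps * a * (8 * W) by ring.
have -> : eps * (b * T%:R) = eps * a * (T%:R * b / a) by field; rewrite gt_eqF.
by rewrite ler_wpM2l// ltW// mulr_gt0.
Qed.

End Rate.

Theorem theorem3 (R : realType) :
  exists mu2 nu2 : R,
    [/\ 0 < mu2, 0 < nu2 & nu2 < 1] /\
    forall (n d : nat) (f : 'I_n -> 'rV[R]_d -> R) (L : 'I_n -> R)
           (xstar x0 : 'rV[R]_d) (q : {set 'I_n} -> R) (v : 'I_n -> R),
      (forall i, smooth (L i) (f i)) ->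
      (forall x, favg f xstar <= favg f x) ->
      0 < Lbar L ->
      is_pmf q ->
      proper_sampling q ->
      eso q v ->
      let b := avg_size q in
      let a := alpha q v L in
      let n23 : R := n%:R `^ (2 / 3) in
      let gap := favg f x0 - favg f xstar in
      let eta := mu2 * b / (a * Lbar L * n23) in
      b <= a * n23 ->
      forall m : nat,
        m%:Z = Num.floor (n%:R * a / (3 * b * mu2)) ->
        (forall T : nat, (0 < T)%N -> (m %| T)%N ->
           svrg_sq_grad q f eta x0 m T <= a * Lbar L * n23 * gap / (b * T%:R * nu2))
        /\
        (forall eps : R, 0 < eps ->
           let N := Num.max n%:R
             (mu2 * Lbar L * n23 * gap / (eps * nu2) * (1 + a / (3 * mu2))) in
           (forall T : nat, (0 < T)%N -> (m %| T)%N ->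
              N <= svrg_evals q m T -> svrg_accurate q f eta x0 m T eps)
           /\
           (n%:R + m%:R * b <= N ->
              exists T : nat, [/\ (0 < T)%N, (m %| T)%N, svrg_evals q m T <= N
                & svrg_accurate q f eta x0 m T eps])).
Proof.
exists 4^-1, 96^-1; split.
  by split; rewrite ?invr_gt0// invf_lt1//; lra.
move=> n d f L xstar x0 q v smf xstar_min l_gt0 q_pmf q_proper ev.
move=> b a n23 gap eta b_le m mE.
have n_gt0 := card_gt0_of_Lbar l_gt0.
have b_gt0 : 0 < b := avg_size_gt0 q_proper n_gt0.
have a_gt0 : 0 < a := alpha_gt0 q_proper l_gt0 b_le.
have n23_ge0 : 0 <= n23 by exact: powR_ge0.
have gap_ge0 : 0 <= gap by rewrite subr_ge0.
have den_gt0 : 0 < 3 * b * 4^-1 by rewrite pmulr_lgt0// pmulr_rgt0.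
have X_ge1 : 1 <= n%:R * a / (3 * b * 4^-1).
  have n23_le : n23 <= n%:R by rewrite ler1_powR ?ler1n//; lra.
  rewrite ler_pdivlMr// mul1r.
  have := le_trans b_le (ler_wpM2l (ltW a_gt0) n23_le); lra.
have /andP[m_le m_gt] := floor_itv (n%:R * a / (3 * b * 4^-1)).
rewrite -mE -[_%:~R]/(m%:R) in m_le; rewrite -mE intrD -[m%:~R]/(m%:R) in m_gt.
have m_gt0 : (0 < m)%N by rewrite -lez_nat mE floor_ge_int.
have m_ge : n%:R * a / (3 * b * 4^-1) <= 2 * m%:R.
  have : 1 <= m%:R :> R by rewrite ler1n.
  lra.
split=> [T T_gt0 mT|eps eps_gt0 N].
  have rate := svrg_rate x0 smf xstar_min q_pmf q_proper ev l_gt0 b_le m_le m_gt0.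
  apply: le_trans (rate T T_gt0 mT) _.
  have Z_ge0 : 0 <= a * Lbar L * n23 * gap.
    by apply: mulr_ge0 => //; apply: mulr_ge0 => //; rewrite ltW// mulr_gt0.
  have TR_gt0 : 0 < T%:R :> R by rewrite ltr0n.
  rewrite -/b -/a -/n23 -/gap.
  have -> : a * Lbar L * n23 * gap / (b * T%:R / 96)
    = 96 * (a * Lbar L * n23 * gap) / (b * T%:R) by field; rewrite !gt_eqF.
  rewrite ler_wpM2r ?invr_ge0//; last lra.
  by rewrite ltW// mulr_gt0.
pose W := Lbar L * n23 * gap / eps * (1 + 4 / 3 * a).
have accurate T : (0 < T)%N -> (m %| T)%N -> N <= 2 * svrg_evals q m T ->
    svrg_accurate q f eta x0 m T eps.
  move=> T_gt0 mT N_le.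
  apply: (svrg_accurate_of_evals smf xstar_min q_pmf q_proper ev l_gt0 b_le m_le) => //.
  rewrite -mulrA -/W.
  have : 24 * W <= N.
    rewrite le_max; apply/orP; right; rewrite le_eqVlt; apply/orP; left.
    by apply/eqP; rewrite /W; field; rewrite gt_eqF.
  lra.
split=> [T T_gt0 mT N_le|].
  apply: accurate => //; apply: le_trans N_le _.
  by rewrite ler_peMl ?mulr_ge0 ?addr_ge0 ?mulr_ge0 ?(ltW b_gt0)//; lra.
set u := n%:R + m%:R * b => u_le.
have u_gt0 : 0 < u by rewrite ltr_pwDl ?ltr0n// mulr_ge0// ltW.
have Nu_ge1 : 1 <= N / u by rewrite ler_pdivlMr// mul1r.
(* As many epochs as the budget allows; at least one fits, so more than half of
   the budget is spent. *)
pose M := Num.truncn (N / u).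
have /andP[M_le M_gt] := truncn_itv (le_trans ler01 Nu_ge1).
have M_gt0 : (0 < M)%N by rewrite truncn_gt0.
have evalsE : svrg_evals q m (M * m) = M%:R * u by rewrite /svrg_evals outer_loopsM.
have MR_ge1 : 1 <= M%:R :> R by rewrite ler1n.
exists (M * m)%N; split; first by rewrite muln_gt0 M_gt0.
- exact: dvdn_mull.
- by rewrite evalsE -ler_pdivlMr.
apply: accurate; rewrite ?muln_gt0 ?M_gt0 ?dvdn_mull// evalsE mulrA.
rewrite -ler_pdivrMr// ltW//; apply: lt_le_trans M_gt _.
by rewrite -natr1 -/M; lra.
Qed.
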